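(* For any positive integer $d$, $\operatorname{ex}_T(\alpha)\leq 2^{d-1}\alpha^{1-1/d}$ for all $\alpha \in (0,2^{-d})$. In particular, there is a constant $C> 0$ such that $\operatorname{ex}_T(\alpha) \leq e^{C \sqrt{\log (1/\alpha)}}\,\alpha$ for all $\alpha \in (0, \tfrac12)$.
   Context: Let $\mathbb{T}=\mathbb{R}/\mathbb{Z}$ and $\mu$ the Lebesgue (Haar) measure on $\mathbb{T}^k$ for each $k$. For an integer $n>1$, let $\pi_1:\mathbb{T}^n\to\mathbb{T}^{n-1}$ be the projection forgetting the first coordinate and $\pi_n:\mathbb{T}^n\to\mathbb{T}^{n-1}$ the projection forgetting the last coordinate. Define $\operatorname{ex}_T(n,\alpha)=\inf\{\mu(\pi_1(B)+\pi_n(B)) : B\subseteq\mathbb{T}^n \text{ open},\ \mu(B)>\alpha\}$ and $\operatorname{ex}_T(\alpha)=\lim_{n\to\infty}\operatorname{ex}_T(n,\alpha)$ (this limit exists since $\operatorname{ex}_T(n,\alpha)$ is non-increasing in $n$). *)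

(* Defs.v *)
From HB Require Import structures.
From mathcomp Require Import all_boot all_order all_algebra ring_quotient.
From mathcomp Require Import all_classical all_reals all_analysis.
From mathcomp Require Import measurable_realfun.

Set Implicit Arguments.
Unset Strict Implicit.
Unset Printing Implicit Defensive.

Import Order.TTheory GRing.Theory Num.Theory.
Import numFieldNormedType.Exports.
Local Open Scope classical_set_scope.
Local Open Scope ring_scope.
Local Open Scope quotient_scope.

Definition Zsub (R : realType) : zmodClosed R :=
  GRing.ZmodClosed.clone R (@Num.int_num_subdef R) _.

Fact in_Zsub (R : realType) (x : R) : (x \in Zsub R) = (x \is a Num.int).
Proof. by []. Qed.

Definition circle (R : realType) : Type := Quotient.quot (Zsub R).

Section circle_structures.
Variable R : realType.

HB.instance Definition _ := EqQuotient.on (circle R).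
HB.instance Definition _ := Choice.on (circle R).
HB.instance Definition _ := GRing.Zmodule.on (circle R).
HB.instance Definition _ := ZmodQuotient.on (circle R).
HB.instance Definition _ := isPointed.Build (circle R) 0.

Definition circle_pi : R -> circle R := \pi_(circle R).

(* Same opens as [quotient_topology], whose choice structure would clash with
   the one of [Quotient.quot] that underlies the group structure. *)
Definition circle_open : set (set (circle R)) :=
  [set U | open (circle_pi @^-1` U)].

Fact circle_openT : circle_open setT.
Proof. by rewrite /circle_open/= preimage_setT; exact: openT. Qed.

Fact circle_openI : setI_closed circle_open.
Proof.
by move=> A B oA oB; rewrite /circle_open/= preimage_setI; exact: openI.
Qed.

Fact circle_open_bigcup (I : Type) (f : I -> set (circle R)) :
  (forall i, circle_open (f i)) -> circle_open (\bigcup_i f i).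
Proof.
move=> fo; rewrite /circle_open/= preimage_bigcup.
by apply: bigcup_open => i _; exact: fo.
Qed.

HB.instance Definition _ := isOpenTopological.Build (circle R)
  circle_openT circle_openI circle_open_bigcup.

HB.instance Definition _ := @isMeasurable.Build
  (sigma_display (@open (circle R))) (circle R) <<s @open (circle R) >>
  (@sigma_algebra0 _ setT _) (@sigma_algebraC _ _)
  (@sigma_algebra_bigcup _ setT _).

End circle_structures.

Section circle_measure.
Variable R : realType.

Fact measurable_itv01 :
  measurable (`[0%R, 1%R[%classic : set (measurableTypeR R)).
Proof. exact: measurable_itv. Qed.

Definition lebesgue01 : set (measurableTypeR R) -> \bar R :=
  mrestr lebesgue_measure measurable_itv01.

HB.instance Definition _ := Measure.on lebesgue01.

Fact lebesgue01_setT : lebesgue01 setT = 1%E.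
Proof.
rewrite /lebesgue01 /mrestr setTI lebesgue_measure_itv/= lte_fin ltr01.
by rewrite oppr0 adde0.
Qed.

HB.instance Definition _ :=
  Measure_isProbability.Build _ _ _ lebesgue01 lebesgue01_setT.

Definition circle_mpi : measurableTypeR R -> circle R := @circle_pi R.

Fact measurable_circle_mpi : measurable_fun setT circle_mpi.
Proof.
apply: (measurability (@open (circle R))) => //.
move=> _ [U oU <-]; rewrite setTI; apply: open_measurable.
exact: oU.
Qed.

HB.instance Definition _ :=
  isMeasurableFun.Build _ _ _ _ circle_mpi measurable_circle_mpi.

Definition circle_haar : probability (circle R) R :=
  distribution lebesgue01 circle_mpi.

Lemma circle_haarE (A : set (circle R)) :
  circle_haar A = lebesgue_measure ((@circle_pi R) @^-1` A `&` `[0%R, 1%R[).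
Proof. by []. Qed.

End circle_measure.

Section torus.
Variable R : realType.

Definition tuple_cons k (p : circle R * k.-tuple (circle R)) :
  k.+1.-tuple (circle R) := [tuple of p.1 :: p.2].

Fact measurable_tuple_cons k : measurable_fun setT (@tuple_cons k).
Proof. by apply: measurable_cons. Qed.

HB.instance Definition _ k :=
  isMeasurableFun.Build _ _ _ _ (@tuple_cons k) (@measurable_tuple_cons k).

(* Tuples carry the product sigma-algebra, row vectors carry the product
   topology and the group structure: the k-fold product measure is built on
   the former and transported to the latter. *)
Fixpoint tuple_haar k : probability (k.-tuple (circle R)) R :=
  if k is k'.+1 then
    distribution (circle_haar R \x tuple_haar k')%E (@tuple_cons k')
  else \d_ [tuple].

Definition haar k (A : set 'rV[circle R]_k) : \bar R :=
  tuple_haar k [set t | A (\row_i tnth t i)].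

Lemma haar_box k (A : 'I_k -> set (circle R)) :
  (forall i, measurable (A i)) ->
  haar [set x : 'rV[circle R]_k | forall i, A i (x ord0 i)] =
  (\prod_(i < k) circle_haar R (A i))%E.
Proof.
rewrite /haar; elim: k A => [|k IHk] A mA.
  by rewrite big_ord0 /= diracE mem_set//=; case.
rewrite big_ord_recl -IHk//=.
set B := [set t : k.-tuple (circle R) | _].
have mB : measurable B.
  rewrite (_ : B = \bigcap_(i in [set: 'I_k])
      (fun t : k.-tuple (circle R) => tnth t i) @^-1` A (lift ord0 i)).
    apply: fin_bigcap_measurable => // i _.
    by rewrite -[X in measurable X]setTI; exact: measurable_tnth.
  apply/seteqP; split=> [t Bt i _|t Bt i] /=; first by have := Bt i; rewrite mxE.
  by rewrite mxE; exact: Bt.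
rewrite -(product_measure1E (circle_haar R) (tuple_haar k))//.
congr ((circle_haar R \x tuple_haar k)%E _).
apply/seteqP; split=> [[x t] At|[x t] /= [Ax Bt] i] /=.
  split=> [|i] /=; first by have := At ord0; rewrite mxE.
  by have := At (lift ord0 i); rewrite !mxE tnthS.
rewrite mxE; case: (unliftP ord0 i) => [j ->|->] //.
by have := Bt j; rewrite mxE tnthS.
Qed.

Definition forget_first k (x : 'rV[circle R]_k.+1) : 'rV[circle R]_k :=
  col' ord0 x.

Definition forget_last k (x : 'rV[circle R]_k.+1) : 'rV[circle R]_k :=
  col' ord_max x.

Definition sumset (V : zmodType) (A B : set V) : set V :=
  [set x + y | x in A & y in B].

(* [exT_dim m alpha] is ex_T(n, alpha) for the dimension n = m + 2, so that m
   ranges over nat exactly when n ranges over the integers n > 1. *)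
Definition exT_dim (m : nat) (alpha : R) : \bar R :=
  ereal_inf
    [set haar (sumset (@forget_first m.+1 @` B) (@forget_last m.+1 @` B))
    | B in [set B : set 'rV[circle R]_m.+2 |
            open B /\ (alpha%:E < haar B)%E]].

(* [limn] is total; the limit does exist since exT_dim m alpha is
   non-increasing in m. *)
Definition exT (alpha : R) : \bar R := limn (exT_dim ^~ alpha).

End torus.

(* Main.v *)
(* For alpha < 2^-d take B = (0,t)^d with t slightly above alpha^(1/d) and
   t <= 1/2: then pi_1(B) + pi_n(B) = (0,2t)^(d-1).  Replacing B by T x B
   replaces pi_1(B) + pi_n(B) by T x (pi_1(B) + pi_n(B)), so ex_T(n, alpha) is
   non-increasing in n and its limit is at most each of its terms.  The second
   bound follows with d close to sqrt (log (1 / alpha)). *)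
Require Import Defs.
From HB Require Import structures.
From mathcomp Require Import all_boot all_order all_algebra.
From mathcomp Require Import all_classical all_reals all_analysis.
From mathcomp Require Import ring_quotient lra.

Import Order.TTheory GRing.Theory Num.Theory.
Import numFieldNormedType.Exports.
Local Open Scope classical_set_scope.
Local Open Scope ring_scope.

(** * Arcs of the circle: openness, measure, sumset *)

Lemma circle_piP {R : realType} (x y : R) :
  reflect (circle_pi x = circle_pi y) (x - y \is a Num.int).
Proof. by rewrite -in_Zsub Quotient.idealrBE; exact: eqP. Qed.

Lemma circle_piD {R : realType} (x y : R) :
  circle_pi (x + y) = circle_pi x + circle_pi y.
Proof. exact: (@Quotient.pi_add _ (Zsub R)). Qed.

(** Defined for every real [r]: empty for [r <= 0] and the whole circle for [r > 1], so the family
    is closed under doubling [r]. *)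
Definition arc {R : realType} (r : R) : set (circle R) :=
  @circle_pi R @` `]0, r[.

Lemma open_arc {R : realType} (r : R) : open (arc r).
Proof.
rewrite /open /= /circle_open /= openE => x /= -[y y0r /esym/circle_piP xyZ].
(* Translation by the integer [x - y] carries a neighbourhood of [x] into []0, r[] without changing
   classes. *)
have xyr : nbhs (x - (x - y)) (`]0, r[%classic : set R).
  by rewrite subKr; apply: open_nbhs_nbhs; split=> //; exact: interval_open.
have cxy : z - (x - y) @[z --> x] --> x - (x - y).
  by apply: cvgB; [exact: cvg_id|exact: cvg_cst].
rewrite /interior; near=> z.
exists (z - (x - y)); first by near: z; exact: cxy.
by apply/circle_piP; rewrite addrAC subrr add0r rpredN.
Unshelve. all: by end_near.
Qed.

Lemma measurable_arc {R : realType} (r : R) : measurable (arc r).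
Proof. by apply: sub_sigma_algebra; exact: open_arc. Qed.

Lemma haar_arc {R : realType} (r : R) : 0 <= r <= 1 ->
  circle_haar R (arc r) = r%:E.
Proof.
move=> /andP[r0 r1]; rewrite circle_haarE.
rewrite (_ : _ `&` _ = `]0, r[%classic); last first.
  apply/seteqP; split=> [x [[y] + /circle_piP/intrP[z yxz]]|x] /=.
    rewrite /= !in_itv/= => /andP[y0 yr] /andP[x0 x1].
    suff z0 : z = 0 by move: yxz; rewrite z0 => /subr0_eq <-; rewrite y0.
    (* Two representatives in [[0, 1[] differ by an integer strictly between -1 and 1. *)
    have : (-1 < z < 1)%R by rewrite -2!(ltr_int R) -yxz; lra.
    by clear; case: z => [[|]|[|]].
  rewrite in_itv/= => /andP[x0 xr]; split.
    by exists x => //=; rewrite in_itv/= x0.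
  by rewrite in_itv/= ltW//= (lt_le_trans xr).
rewrite lebesgue_measure_itv/= lte_fin.
by case: ltgtP r0 => // [_|<-]; rewrite ?oppr0 ?adde0.
Qed.

Lemma sumset_arc {R : realType} (r : R) :
  sumset (arc r) (arc r) = arc (2 * r).
Proof.
apply/seteqP; split=> [_ [_ [x + <-]] [_ [y + <-]] <-|_ [x + <-]];
    rewrite /= !in_itv/=.
  move=> x0r y0r; exists (x + y); last exact: circle_piD.
  by rewrite /= in_itv/=; lra.
(* A point of the longer arc is twice the class of half its representative. *)
move=> x0r; have xr : arc r (circle_pi (x / 2)).
  by exists (x / 2) => //=; rewrite in_itv/=; lra.
exists (circle_pi (x / 2)) => //; exists (circle_pi (x / 2)) => //.
by rewrite -circle_piD -splitr.
Qed.

(** * Boxes with equal sides in the torus *)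

Definition box {R : realType} {k} (A : set (circle R)) : set 'rV[circle R]_k :=
  [set x | forall i, A (x ord0 i)].

Lemma open_box {R : realType} {k} (A : set (circle R)) :
  open A -> open (@box R k A).
Proof.
move=> oA; rewrite openE => x Ax; exists (fun _ _ => A) => [i j|y Ay j] /=.
  by rewrite ord1; apply: open_nbhs_nbhs; split=> //; exact: Ax.
exact: Ay.
Qed.

Definition cons_rV {T : Type} {k} (a : T) (x : 'rV[T]_k) : 'rV[T]_k.+1 :=
  \row_i if unlift ord0 i is Some j then x ord0 j else a.

Lemma cons_rVK {T : Type} {k} (a : T) (x : 'rV[T]_k) :
  col' ord0 (cons_rV a x) = x.
Proof. by apply/rowP => i; rewrite !mxE liftK. Qed.

Lemma cons_rV0 {T : Type} {k} (a : T) (x : 'rV[T]_k) :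
  cons_rV a x ord0 ord0 = a.
Proof. by rewrite mxE unlift_none. Qed.

Lemma eq_rV_first {T : Type} {k} (x y : 'rV[T]_k.+1) :
  x ord0 ord0 = y ord0 ord0 -> col' ord0 x = col' ord0 y -> x = y.
Proof.
move=> xy0 /rowP xy; apply/rowP => i.
by case: (unliftP ord0 i) => [j|] -> //; have := xy j; rewrite !mxE.
Qed.

(** The deleted index is arbitrary so that both projections are covered; a point of [A] fills the
    missing coordinate. *)
Lemma image_forget_box {R : realType} {k} (i0 : 'I_k.+1) (A : set (circle R)) :
  A !=set0 -> col' i0 @` box A = box A.
Proof.
move=> [a Aa]; apply/seteqP; split=> [_ [x Ax <-] i|x Ax]; first by rewrite mxE.
exists (\row_i if unlift i0 i is Some j then x ord0 j else a).
  by move=> i /=; rewrite mxE; case: unlift => [j|//]; exact: Ax.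
by apply/rowP => i; rewrite !mxE liftK.
Qed.

Lemma sumset_box {R : realType} {k} (A B : set (circle R)) :
  sumset (@box R k A) (box B) = box (sumset A B).
Proof.
apply/seteqP; split=> [_ [x Ax [y By <-]] i|x ABx].
  by rewrite mxE; exists (x ord0 i) => //; exists (y ord0 i).
have /choice[f fP] i : exists ab, [/\ A ab.1, B ab.2 & ab.1 + ab.2 = x ord0 i].
  by have [a Aa [b Bb <-]] := ABx i; exists (a, b).
exists (\row_i (f i).1); first by move=> i; rewrite mxE; have [] := fP i.
exists (\row_i (f i).2); first by move=> i; rewrite mxE; have [] := fP i.
by apply/rowP => i; rewrite !mxE; have [] := fP i.
Qed.

Lemma haar_box_arc {R : realType} {k} (r : R) : 0 <= r <= 1 ->
  haar (@box R k (arc r)) = (r ^+ k)%:E.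
Proof.
move=> r01; rewrite (haar_box (fun=> measurable_arc r)).
rewrite (eq_bigr (fun=> r%:E)) ?prodEFin ?prodr_const ?card_ord// => ? _.
exact: haar_arc.
Qed.

(** * Monotonicity in the dimension *)

(* Outside the sigma-algebra, [\x] is still the integral of the measures of
   the sections, here all equal to [A]. *)
Lemma haar_forget_first {R : realType} {k} (A : set 'rV[circle R]_k) :
  haar (@forget_first R k @^-1` A) = haar A.
Proof.
rewrite /haar /= /pushforward /product_measure1.
rewrite (eq_integral (cst (tuple_haar R k [set t | A (\row_i tnth t i)]))).
  rewrite integral_cst; last exact: measurableT.
  rewrite [X in (_ * X)%E](_ : _ = 1%E) ?mule1//.
  exact: (@probability_setT _ _ _ (circle_haar R)).
move=> x _; congr (tuple_haar R k _); apply/seteqP; split=> t.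
  by move/xsectionP; congr A; apply/rowP => i; rewrite !mxE tnthS.
move=> At; apply/xsectionP; congr A: At.
by apply/rowP => i; rewrite !mxE tnthS.
Qed.

Lemma open_forget_first {R : realType} k (B : set 'rV[circle R]_k) :
  open B -> open (@forget_first R k @^-1` B).
Proof.
rewrite !openE => oB x /oB[P Px PB].
(* Basic neighbourhoods are given entrywise; the new first coordinate is left free. *)
exists (fun i j => if unlift ord0 j is Some j' then P i j' else setT).
  move=> i j; case: (unliftP ord0 j) => [j' ->|_]; last exact: filterT.
  by have := Px i j'; rewrite mxE.
move=> y Py; apply: PB => i j; rewrite mxE.
by have := Py i (lift ord0 j); rewrite liftK.
Qed.

(** If [g z = g x + f] with [x] in [B] and [f] in [F], then [z - x] lies in the preimage of [F]. *)
Lemma sumset_preimage (V W : zmodType) (g : {additive V -> W}) (B : set V)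
  (F : set W) : sumset B (g @^-1` F) = g @^-1` (sumset (g @` B) F).
Proof.
apply/seteqP; split=> [_ [x Bx [y Fy <-]]|z [_ [x Bx <-] [f Ff fz]]] /=.
  by exists (g x); [exists x|exists (g y) => //; rewrite raddfD].
exists x => //; exists (z - x); last by rewrite addrC subrK.
by rewrite /= raddfB -fz addrC addKr.
Qed.

(** The first projection of T x B is B and the last one is T x pi_n(B); adding B to this cylinder
    gives the cylinder over pi_1(B) + pi_n(B). *)
Lemma sumset_forget_preimage {R : realType} k (B : set 'rV[circle R]_k.+1) :
  sumset (@forget_first R k.+1 @` (@forget_first R k.+1 @^-1` B))
         (@forget_last R k.+1 @` (@forget_first R k.+1 @^-1` B)) =
  @forget_first R k @^-1` sumset (@forget_first R k @` B)
                                 (@forget_last R k @` B).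
Proof.
have forgetC (x : 'rV[circle R]_k.+2) :
    forget_first (forget_last x) = forget_last (forget_first x).
  apply/rowP => i; rewrite !mxE; congr (x _ _); apply/val_inj => /=.
  by rewrite /bump/= !add1n ltnS leqNgt ltn_ord.
have -> : @forget_first R k.+1 @` (@forget_first R k.+1 @^-1` B) = B.
  rewrite image_preimage//; apply/seteqP; split=> // x _.
  by exists (cons_rV 0 x) => //; exact: cons_rVK.
have -> : @forget_last R k.+1 @` (@forget_first R k.+1 @^-1` B) =
    @forget_first R k @^-1` (@forget_last R k @` B).
  apply/seteqP; split=> [_ [x Bx <-]|y [b Bb by_]] /=.
    by exists (forget_first x) => //; rewrite forgetC.
  have xb := cons_rVK (y ord0 ord0) b.
  exists (cons_rV (y ord0 ord0) b); first by rewrite /= /forget_first xb.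
  apply: eq_rV_first.
    rewrite mxE -[RHS](cons_rV0 _ b); congr (cons_rV _ _ _ _).
    exact/val_inj.
  by rewrite -[LHS]/(forget_first _) forgetC /forget_first xb by_.
exact: (@sumset_preimage _ _ (@forget_first R k)).
Qed.

Lemma exT_dim_nonincreasing {R : realType} (alpha : R) :
  nonincreasing_seq (fun m => exT_dim m alpha).
Proof.
apply/nonincreasing_seqP => m; apply: ereal_inf_le_tmp => _ [B [oB aB] <-].
exists (@forget_first R m.+2 @^-1` B); last first.
  by rewrite sumset_forget_preimage haar_forget_first.
by split; [exact: open_forget_first|rewrite haar_forget_first].
Qed.

(** * Upper bounds from explicit open sets *)

Lemma exT_le {R : realType} (alpha : R) m (B : set 'rV[circle R]_m.+2) :
  open B -> (alpha%:E < haar B)%E ->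
  (exT alpha <= haar (sumset (@forget_first R m.+1 @` B)
                             (@forget_last R m.+1 @` B)))%E.
Proof.
move=> oB aB; apply: (@le_trans _ _ (exT_dim m alpha)).
  (* A nonincreasing sequence of extended reals converges to its infimum, so [limn] is a genuine
     limit here. *)
  have /ereal_nonincreasing_cvgn/cvg_lim := exT_dim_nonincreasing alpha.
  rewrite /exT => -> //.
  by apply: ereal_inf_lbound; exists m.
by apply: ereal_inf_lbound; exists B.
Qed.

(** The bound stays a Haar measure because [arc (2 * t)] has measure [2 * t] only for [t <= 1 / 2],
    while [t = 1] yields the trivial bound. *)
Lemma exT_le_haar_arc {R : realType} (alpha : R) m (t : R) :
  0 < t <= 1 -> alpha < t ^+ m.+2 ->
  (exT alpha <= haar (@box R m.+1 (arc (2 * t))))%E.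
Proof.
move=> t01 at_.
have a0 : arc t !=set0.
  by exists (circle_pi (t / 2)); exists (t / 2) => //=; rewrite in_itv/=; lra.
have aB : (alpha%:E < haar (@box R m.+2 (arc t)))%E.
  by rewrite haar_box_arc ?lte_fin//; lra.
have := exT_le alpha m _ (open_box _ (open_arc t)) aB.
by rewrite /forget_first /forget_last !image_forget_box// sumset_box sumset_arc.
Qed.

(** Settles the exponent 1 of the first bound, for which no box is at hand since dimensions start at
    2. *)
Lemma exT_le1 {R : realType} (alpha : R) : alpha < 1 -> (exT alpha <= 1)%E.
Proof.
move=> a1; apply: (@le_trans _ _ (haar (@box R 1 (arc (2 * 1))))).
  by apply: exT_le_haar_arc; rewrite ?expr1n//; lra.
rewrite (haar_box (fun=> measurable_arc (2 * 1))) big_ord1.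
by apply: probability_le1; exact: measurable_arc.
Qed.

(** The cube of side [s = alpha ^ (1 / d.+1)] has measure exactly [alpha], but admissible sets need
    strictly more; hence sides [t > s] are used and [t] tends to [s] from the right. *)
Lemma exT_le_powR {R : realType} (alpha : R) (d : nat) :
  0 < alpha -> alpha < 2 ^- d.+1 ->
  (exT alpha <= (2 ^+ d * alpha `^ (1 - 1 / d.+1%:R))%:E)%E.
Proof.
case: d => [|m] a0 ad.
  rewrite expr0 mul1r divr1 subrr powRr0; apply: exT_le1; lra.
set s := alpha `^ (1 / m.+2%:R).
have m2 : m.+2%:R != 0 :> R by rewrite pnatr_eq0.
have s0 : 0 < s by exact: powR_gt0.
have sE : s ^+ m.+2 = alpha.
  by rewrite -powR_mulrn ?ltW// -powRrM divfK// powRr1// ltW.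
have -> : 2 ^+ m.+1 * alpha `^ (1 - 1 / m.+2%:R) = (2 * s) ^+ m.+1.
  rewrite exprMn; congr (_ * _); rewrite -powR_mulrn ?ltW// -powRrM.
  congr (_ `^ _); rewrite -{1}(divff m2) -mulrBl.
  by rewrite -[X in X - 1]natr1 addrK div1r mulrC.
(* This leaves room for [s < t < 1 / 2], where the doubled arc still has measure [2 * t]. *)
have s12 : s < 1 / 2.
  rewrite -(ltr_pXn2r (ltn0Sn m.+1)) ?nnegrE ?ltW ?divr_gt0//.
  by rewrite sE div1r exprVn.
have cX : (2 * t) ^+ m.+1 @[t --> s^'+] --> (2 * s) ^+ m.+1.
  apply: cvg_within_filter.
  have := @exprn_continuous _ m.+1 (2 * s).
  by apply: cvg_comp; exact: mulrl_continuous.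
apply: (cvge_ge (f := fun t => ((2 * t) ^+ m.+1)%:E) (F := s^'+)); last first.
  by apply: cvg_EFin; [exact: nearW|exact: cX].
near=> t.
have st : s < t by near: t; exact: nbhs_right_gt.
have t12 : t < 1 / 2 by near: t; exact: nbhs_right_lt.
rewrite -haar_box_arc; last by lra.
apply: exT_le_haar_arc; first lra.
by rewrite -sE ltr_pXn2r// nnegrE; lra.
Unshelve. all: by end_near.
Qed.

Theorem theorem2p2 (R : realType) :
  (forall (d : nat), (0 < d)%N ->
     forall alpha : R, 0 < alpha -> alpha < 2 ^- d ->
       (exT alpha <= (2 ^+ (d - 1) * alpha `^ (1 - 1 / d%:R))%:E)%E) /\
  (exists C : R, 0 < C /\
     forall alpha : R, 0 < alpha -> alpha < 1 / 2 ->
       (exT alpha <= (expR (C * Num.sqrt (ln (1 / alpha))) * alpha)%:E)%E).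
Proof.
split=> [[//|d] _ alpha|]; first by rewrite subn1; exact: exT_le_powR.
(* With [r = sqrt L], the constant is 1 + 2: the factor [2 ^+ d] costs at most [expR r], and the
   loss [1 / d.+1] in the exponent of [alpha] at most [expR (2 * r)]. *)
exists 3; split=> // alpha a0 a12.
set L := ln (1 / alpha).
have lnaE : ln alpha = - L by rewrite /L div1r lnV// opprK.
have aE : alpha = expR (- L) by rewrite -lnaE lnK.
have ln2L : ln 2 < L.
  by rewrite ltr_ln ?posrE// ?divr_gt0// ltr_pdivlMr//; lra.
have ln20 : 0 < ln 2 :> R by rewrite ln_gt0//; lra.
have ln21 : ln 2 < 1 :> R.
  rewrite -[X in _ < X]expRK ltr_ln ?posrE ?expR_gt0//.
  exact: expR_gt1Dx.
set r := Num.sqrt L.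
have r0 : 0 < r by rewrite sqrtr_gt0; lra.
have rL : r ^+ 2 = L by rewrite sqr_sqrtr; lra.
(* The first two conditions bound these two costs; the third says [alpha < 2 ^- d.+1]. *)
have [d [dr rd dL]] : exists d : nat,
    [/\ d%:R <= r, r <= 2 * d.+1%:R & d.+1%:R * ln 2 < L].
  have [r1|r1] := ltP r 1; first by exists 0; split; rewrite ?mul1r//; lra.
  (* For [r >= 1] the exponent [d.+1] is the integer part of [r], and
     [d.+1 * ln 2 < d.+1 <= r <= r ^+ 2 = L]. *)
  have := truncn_itv (ltW r0); have := r1; rewrite -truncn_gt0.
  case: (Num.truncn r) => // d _ /andP[].
  rewrite -[d.+2%:R]natr1 -![d.+1%:R]natr1 => d1r rd2.
  have d0 : 0 <= d%:R :> R by [].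
  have dln2 : (d%:R + 1) * ln 2 < d%:R + 1 :> R.
    by rewrite -[ltRHS]mulr1 ltr_pM2l//; lra.
  have rL1 : r <= L by rewrite -rL expr2 ler_peMr//; lra.
  by exists d; rewrite -![d.+1%:R]natr1; split; lra.
apply: (le_trans (@exT_le_powR _ alpha d a0 _)).
  rewrite -ltr_ln ?posrE// ?invr_gt0 ?exprn_gt0// lnV ?posrE ?exprn_gt0//.
  by rewrite lnXn// lnaE ltrN2 -[_ *+ d.+1]mulr_natl.
have d1 : 0 < d.+1%:R :> R by [].
(* With both sides written as exponentials, it remains to compare exponents: [d * ln 2 - (1 - 1 /
   d.+1) * L <= 3 * r - L]. *)
rewrite lee_fin -[2 ^+ d]lnK ?posrE ?exprn_gt0// lnXn//.
rewrite /powR gt_eqF// -expRD [X in _ <= _ * X]aE -expRD ler_expR lnaE.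
have : 1 / d.+1%:R * L <= 2 * r.
  by rewrite div1r mulrC ler_pdivrMr// -rL expr2 mulrAC ler_wpM2r// ltW.
have : ln 2 *+ d <= r.
  rewrite -[_ *+ d]mulr_natr (le_trans _ dr)// ler_piMl//; lra.
set q := 1 / _; lra.
Qed.
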